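(* Let $(Q,\sigma)$ be a totally proper cyclically ordered quiver on $n$ vertices whose quiver $Q$ is mutation-acyclic. Then the Markov invariant $M_Q$ and the determinant of the exchange matrix $B_Q$ satisfy $$\det(B_Q)\le (2M_Q)^{n/2}.$$
   Context: A quiver is a finite directed graph with parallel edges (arrows) allowed and no oriented cycles of length 1 or 2; all vertices are mutable. Write $u\to v$ if there is at least one arrow from $u$ to $v$; $\mathrm{In}(v)=\{u: u\to v\}$, $\mathrm{Out}(v)=\{u: v\to u\}$. Exchange matrix: $B_Q=(b_{uv})$, $b_{uv}=\#\{\text{arrows }u\to v\}-\#\{\text{arrows }v\to u\}$. Mutation $\mu_v(Q)$: (1) for each oriented path $u\to v\to w$ add a new arrow $u\to w$ (with multiplicity); (2) reverse all arrows incident to $v$; (3) remove oriented 2-cycles one at a time until none remain. Quivers are mutation equivalent if related by a sequence of mutations; mutation-acyclic means mutation equivalent to an acyclic quiver (one without directed cycles). A cyclic ordering $\sigma$ is a linear ordering up to cyclic shifts; the linear orderings in this class are associated to $\sigma$. Moving clockwise means moving in the increasing direction (wrapping around). A cyclically ordered quiver (COQ) $(Q,\sigma)$ is a quiver with a cyclic ordering of its vertices. An oriented path $u\to v\to w$ makes a right turn at $v$ if $u<v<w$ in some linear order associated to $\sigma$; $v$ is proper if every oriented path $u\to v\to w$ makes a right turn at $v$. A wiggle fixes $Q$ and transposes two vertices adjacent in the cyclic ordering and not joined by an arrow of $Q$; wiggle equivalence is the generated equivalence relation. A COQ is proper if for every vertex $v$ there is a wiggle equivalent COQ in which $v$ is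 proper. To mutate a COQ at a proper vertex $v$, replace $Q$ by $\mu_v(Q)$ and move $v$ clockwise, from its original position, past all elements of $\mathrm{In}(v)$ (each once) without passing any element of $\mathrm{Out}(v)$, with In and Out computed in the mutated quiver (well defined up to wiggle equivalence). The proper mutation class of a COQ is the set of COQs obtainable by sequences of such proper mutations and wiggles. A COQ is totally proper if every COQ in its proper mutation class is proper. A unipotent companion of $(Q,\sigma)$ is, for a linear order $<$ associated to $\sigma$, the unipotent upper triangular matrix $U$ with $U^T-U=B_Q$, rows and columns written in the order $<$. The Alexander polynomial is $\Delta_Q(t)=\det(tU-U^T)$ (independent of the choice of $<$), and the Markov invariant is $M_Q=n+(\text{coefficient of }t^{n-1}\text{ in }\Delta_Q(t))$. *)

(* Defs.v *)
From Stdlib Require Import Relation_Operators.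
From HB Require Import structures.
From mathcomp Require Import all_boot all_order all_algebra.
From mathcomp Require Import reals exp.

Set Implicit Arguments.
Unset Strict Implicit.
Unset Printing Implicit Defensive.

Import Order.TTheory GRing.Theory Num.Theory.
Local Open Scope ring_scope.

(* [arrows u v] is the number of arrows from u to v. *)
Record quiver (n : nat) := Quiver {
  arrows :> 'M[nat]_n;
  no_loop : [forall u, arrows u u == 0%N];
  no_2cycle : [forall u, forall v, (arrows u v == 0%N) || (arrows v u == 0%N)] }.

Definition arrow n (Q : quiver n) : rel 'I_n := fun u v => (0 < Q u v)%N.

Definition In n (Q : quiver n) (v : 'I_n) : {set 'I_n} := [set u | arrow Q u v].
Definition Out n (Q : quiver n) (v : 'I_n) : {set 'I_n} := [set u | arrow Q v u].

Definition exchange_mx n (Q : quiver n) : 'M[int]_n :=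
  \matrix_(u, v) ((Q u v)%:Z - (Q v u)%:Z).

Section Mutation.
Variables (n : nat) (v : 'I_n).

Definition add_paths (q : 'M[nat]_n) : 'M[nat]_n :=
  \matrix_(u, w) (q u w + q u v * q v w)%N.

Definition reverse_at (q : 'M[nat]_n) : 'M[nat]_n :=
  \matrix_(u, w) (if (u == v) || (w == v) then q w u else q u w).

(* The subtraction is truncated: min(q u w, q w u) oriented 2-cycles between u
   and w are removed, and so are loops (there are none after the two steps
   above). *)
Definition cancel_2cycles (q : 'M[nat]_n) : 'M[nat]_n :=
  \matrix_(u, w) (q u w - q w u)%N.

Lemma cancel_no_loop q : [forall u, cancel_2cycles q u u == 0%N].
Proof. by apply/forallP=> u; rewrite mxE subnn. Qed.

Lemma cancel_no_2cycle q :
  [forall u, forall w, (cancel_2cycles q u w == 0%N) ||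
                       (cancel_2cycles q w u == 0%N)].
Proof.
by apply/forallP=> u; apply/forallP=> w; rewrite !mxE !subn_eq0 leq_total.
Qed.

Definition mutation (Q : quiver n) : quiver n :=
  let q := reverse_at (add_paths Q) in
  Quiver (cancel_no_loop q) (cancel_no_2cycle q).

End Mutation.

Definition mutation_equiv n : quiver n -> quiver n -> Prop :=
  clos_refl_trans _ (fun Q Q' => exists v, Q' = mutation v Q).

Definition acyclic n (Q : quiver n) : Prop :=
  forall c : seq 'I_n, cycle (arrow Q) c -> c = [::].

Definition mutation_acyclic n (Q : quiver n) : Prop :=
  exists2 Q', mutation_equiv Q Q' & acyclic Q'.

(* The cyclic ordering of a COQ is represented by one of its associated linear
   orderings [lin], listed increasingly; the associated linear orderings are
   the [rot k lin]. Elements of [coq n] related by [same_coq] denote the same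
   cyclically ordered quiver, and the relations on COQs below are stated up to
   [same_coq]. *)
Record coq (n : nat) := COQ {
  quiv :> quiver n;
  lin : n.-tuple 'I_n;
  lin_uniq : uniq lin }.

Definition same_coq n (C C' : coq n) : Prop :=
  quiv C' = quiv C /\ exists k, lin C' = rot k (lin C) :> seq 'I_n.

Definition right_turn n (C : coq n) (u v w : 'I_n) : Prop :=
  exists k, let s := rot k (lin C) in (index u s < index v s < index w s)%N.

Definition proper_vertex n (C : coq n) (v : 'I_n) : Prop :=
  forall u w, arrow C u v -> arrow C v w -> right_turn C u v w.

Definition wiggle n (C C' : coq n) : Prop :=
  quiv C' = quiv C /\
  exists (u v : 'I_n) (s : seq 'I_n) (k k' : nat),
    [/\ ~~ arrow C u v, ~~ arrow C v u,
        rot k (lin C) = [:: u, v & s] & rot k' (lin C') = [:: v, u & s]].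

Definition wiggle_equiv n : coq n -> coq n -> Prop :=
  clos_refl_sym_trans _ (fun C C' => same_coq C C' \/ wiggle C C').

Definition proper_coq n (C : coq n) : Prop :=
  forall v, exists2 C', wiggle_equiv C C' & proper_vertex C' v.

(* Cutting the circle just before v, the vertices met clockwise from v are
   those of [p ++ s]; the vertex v is moved past exactly those of p. In and Out
   are taken in the mutated quiver. *)
Definition coq_mutation n (v : 'I_n) (C C' : coq n) : Prop :=
  [/\ proper_vertex C v,
      quiv C' = mutation v C
    & exists (p s : seq 'I_n) (k k' : nat),
      [/\ rot k (lin C) = v :: p ++ s, rot k' (lin C') = p ++ v :: s,
          {subset In C' v <= p} & forall w, w \in p -> w \notin Out C' v]].

Definition proper_mutation_class n : coq n -> coq n -> Prop :=
  clos_refl_trans _ (fun C C' =>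
    [\/ same_coq C C', wiggle C C' | exists v, coq_mutation v C C']).

Definition totally_proper n (C : coq n) : Prop :=
  forall C', proper_mutation_class C C' -> proper_coq C'.

(* The exchange matrix with rows and columns written in the order [lin C]. *)
Definition ordered_exchange_mx n (C : coq n) : 'M[int]_n :=
  \matrix_(i, j) exchange_mx C (tnth (lin C) i) (tnth (lin C) j).

Definition companion n (C : coq n) : 'M[int]_n :=
  \matrix_(i, j) (if (i < j)%N then - ordered_exchange_mx C i j
                  else (i == j)%:R).

Lemma companionP n (C : coq n) (U : 'M[int]_n) :
  [/\ forall i j : 'I_n, (j < i)%N -> U i j = 0,
      forall i, U i i = 1
    & U^T - U = ordered_exchange_mx C]
  <-> U = companion C.
Proof.
have BN i j : ordered_exchange_mx C i j = - ordered_exchange_mx C j i.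
  by rewrite !mxE opprB.
split=> [[Ulow Udiag UB]|->].
  apply/matrixP=> i j; rewrite !mxE; case: (ltngtP i j) => [ij|ji|/val_inj->].
  - by move/matrixP/(_ i j): UB; rewrite !mxE Ulow // sub0r => <-; rewrite opprK.
  - by rewrite Ulow //; case: eqP ji => // ->; rewrite ltnn.
  - by rewrite Udiag eqxx.
split=> [i j ji|i|].
- by rewrite mxE ltnNge ltnW //=; case: eqP ji => // ->; rewrite ltnn.
- by rewrite mxE ltnn eqxx.
apply/matrixP=> i j; rewrite !mxE -!(inj_eq val_inj) /=.
by case: (ltngtP i j) => [_|_|/val_inj->];
  rewrite ?subrr // ?subr0 ?sub0r ?opprK ?opprB.
Qed.

Definition alexander n (C : coq n) : {poly int} :=
  \det ('X *: map_mx polyC (companion C) - map_mx polyC (companion C)^T).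

Definition markov n (C : coq n) : int := n%:Z + (alexander C)`_n.-1.

(* Main.v *)
From Stdlib Require Import Relation_Operators.
Require Import Defs.
From mathcomp Require Import all_boot all_order all_algebra.
From mathcomp Require Import perm reals exp.
From mathcomp Require Import zify ring.

(** Write [U] for a unipotent companion and [Delta(t) = det (tU - U^T)]. Since
    [U - U^T = - B], the value [Delta(1)] is [det B] up to sign, so [det B ^ 2]
    and the Markov invariant both depend on [Delta] only. The plan is to compute
    [Delta] on an acyclic quiver of the mutation class.

    Invariance. The entry of [tU - U^T] at an arrow [u -> v] is, up to the
    number of arrows, a power of [t] which records whether the arrow crosses
    the point where the circle is cut ([wraps]). Changing this 0/1 cochain by a
    coboundary [f v - f u] ([gauge]) conjugates the matrix by the diagonal
    matrix of the [t ^ f u], so [Delta] only sees the cohomology class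
    ([seifert_poly_gauge]). Cyclic shifts and wiggles change the cochain by a
    coboundary; a proper mutation replaces [U] by [G U G^T] with [G ^ 2 = 1]
    ([seifert_poly_mutation]). Total properness makes every mutation of quivers
    a proper one, so the mutations leading to an acyclic quiver lift to cyclically
    ordered quivers, with the same [Delta] ([totally_proper_reach]).

    The cyclic order of an acyclic quiver. A totally proper order on an acyclic
    quiver has the cohomology class of the orders which increase along all
    arrows, for which no arrow wraps ([acyclic_gauge]). Equivalently, the signed
    number of wrapping arrows ([winding]) vanishes around every closed walk.
    Walks with a repetition or a chord decompose into shorter ones, which
    leaves the chordless cycles; the crucial lemma [chordless_cycle_sum] says
    that in any totally proper quiver a chordless cycle which is not an
    oriented cycle has winding 0. If the cycle passes through [u -> v -> w], the
    mutation at [v] creates an arrow [u -> w] and shortens the cycle by one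
    vertex without changing its winding, and a triangle is settled by the
    definition of a proper vertex. If it does not, then mutating at a
    source of the cycle creates such a passage.

    The estimate. With the class of the increasing orders, [Delta] is the
    polynomial of [U = 1 - N], where [N] is the matrix of arrow numbers. It is
    nilpotent, the inverse [S] of [U] counts walks, and
    [M = n - tr (S U^T) = sum S_uv N_uv], which is at least [sum N_uv ^ 2],
    half the squared Frobenius norm of [B]. Finally the squared determinant of an
    [n] by [n] matrix is at most the [n]-th power of its squared Frobenius norm
    ([det_sqr_le]). *)

Set Implicit Arguments.
Unset Strict Implicit.
Unset Printing Implicit Defensive.

Import Order.TTheory GRing.Theory Num.Theory.
Local Open Scope ring_scope.

(** * Determinants and the Frobenius norm *)

(** Lagrange's identity: twice the difference of the two sides is a sum of
    squares. *)
Lemma cauchy_schwarz_sum (R : realDomainType) (I : finType) (a b : I -> R) :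
  (\sum_i a i * b i) ^+ 2 <= (\sum_i a i ^+ 2) * (\sum_i b i ^+ 2).
Proof.
have lagrange : \sum_i \sum_j (a i * b j - a j * b i) ^+ 2
    = ((\sum_i a i ^+ 2) * (\sum_i b i ^+ 2) - (\sum_i a i * b i) ^+ 2) *+ 2.
  rewrite mulr2n {2}[_ * (\sum_i b i ^+ 2)]mulrC expr2 !big_distrlr /=.
  rewrite -!sumrB -big_split /=; apply: eq_bigr => i _.
  by rewrite -!sumrB -big_split /=; apply: eq_bigr => j _; ring.
rewrite -subr_ge0 -(pmulrn_lge0 _ (isT : 0 < 2)%N) -lagrange.
by apply: sumr_ge0 => i _; apply: sumr_ge0 => j _; apply: sqr_ge0.
Qed.

(** A weak form of Hadamard's inequality, by induction on the size. Adding up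
    the Laplace expansions along all rows writes [n * det A] as the scalar product of
    [A] with its cofactor matrix; in the Cauchy-Schwarz inequality the factor
    [n ^ 2] on the left absorbs the number of cofactors on the right. *)
Lemma det_sqr_le (R : realDomainType) n (A : 'M[R]_n) :
  (\det A) ^+ 2 <= (\sum_i \sum_j A i j ^+ 2) ^+ n.
Proof.
elim: n A => [|n IHn] A; first by rewrite det_mx00 expr1n.
set F := \sum_i _.
have row_ge0 m (r : 'I_m -> R) : 0 <= \sum_j r j ^+ 2.
  by apply: sumr_ge0 => j _; apply: sqr_ge0.
have F_ge0 : 0 <= F by apply: sumr_ge0.
have cofactor_le i j : cofactor A i j ^+ 2 <= F ^+ n.
  rewrite /cofactor exprMn sqrr_sign mul1r (le_trans (IHn _)) //.
  apply: lerXn2r; rewrite ?nnegrE //; first by apply: sumr_ge0.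
  rewrite /F (bigD1_ord i) //= ler_wpDl ?row_ge0 //; apply: ler_sum => k _.
  rewrite (bigD1_ord j) //= ler_wpDl ?sqr_ge0 //.
  by apply: ler_sum => l _; rewrite !mxE.
have sum_det : \sum_(p : 'I_n.+1 * 'I_n.+1) A p.1 p.2 * cofactor A p.1 p.2
    = n.+1%:R * \det A.
  rewrite -(pair_big xpredT xpredT (fun i j => A i j * cofactor A i j)) /=.
  under eq_bigr => i _ do rewrite -expand_det_row.
  by rewrite sumr_const card_ord mulr_natl.
have := cauchy_schwarz_sum (fun p : 'I_n.+1 * 'I_n.+1 => A p.1 p.2)
                           (fun p => cofactor A p.1 p.2).
rewrite sum_det -(pair_big xpredT xpredT (fun i j => A i j ^+ 2)) /= -/F => le1.
have le2 : \sum_(p : 'I_n.+1 * 'I_n.+1) cofactor A p.1 p.2 ^+ 2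
    <= n.+1%:R ^+ 2 * F ^+ n.
  apply: (le_trans (ler_sum _ (fun p _ => cofactor_le p.1 p.2))).
  by rewrite sumr_const card_prod card_ord -[X in X <= _]mulr_natl natrM.
have := le_trans le1 (ler_wpM2l F_ge0 le2).
by rewrite exprMn [X in _ <= X]mulrCA -exprS ler_pM2l ?exprn_gt0 ?ltr0n.
Qed.

(** * The polynomial det (tU - U^T) *)

(** For a Seifert matrix [U] of a knot this is its Alexander polynomial. *)
Definition seifert_poly (R : comNzRingType) n (U : 'M[R]_n) : {poly R} :=
  \det ('X *: map_mx polyC U - map_mx polyC U^T).

Lemma seifert_poly_congr (R : comNzRingType) n (G U : 'M[R]_n) :
  seifert_poly (G *m U *m G^T) = ((\det G) ^+ 2)%:P * seifert_poly U.
Proof.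
rewrite /seifert_poly.
have -> : 'X *: map_mx polyC (G *m U *m G^T) - map_mx polyC (G *m U *m G^T)^T
    = map_mx polyC G *m ('X *: map_mx polyC U - map_mx polyC U^T)
      *m map_mx polyC G^T.
  rewrite !trmx_mul trmxK !map_mxM mulmxBr mulmxBl -!mulmxA.
  by rewrite -scalemxAl -scalemxAr.
by rewrite !det_mulmx !det_map_mx det_tr expr2 polyCM; ring.
Qed.

Lemma seifert_poly_relabel (R : comNzRingType) n (U : 'M[R]_n) (s : 'S_n) :
  seifert_poly (mxsub s s U) = seifert_poly U.
Proof.
have -> : mxsub s s U = perm_mx s *m U *m (perm_mx s)^T.
  rewrite tr_perm_mx -row_permE -col_permE.
  by apply/matrixP => i j; rewrite !mxE.
by rewrite seifert_poly_congr det_perm sqrr_sign mul1r.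
Qed.

Lemma seifert_poly_horner1 (R : comNzRingType) n (U : 'M[R]_n) :
  (seifert_poly U).[1] = \det (U - U^T).
Proof.
rewrite -[LHS]/(horner_eval 1 _) -det_map_mx; congr (\det _).
by apply/matrixP => i j; rewrite !mxE /= /horner_eval !hornerE.
Qed.

(** For invertible [U] the two top coefficients of the polynomial can be read
    off from the characteristic polynomial of [U^-1 U^T]. *)
Lemma seifert_poly_char (R : comNzRingType) n (U V : 'M[R]_n) :
  V *m U = 1%:M -> seifert_poly U = (\det U)%:P * char_poly (V *m U^T).
Proof.
move=> VU1; have UV1 := mulmx1C VU1.
rewrite -(det_map_mx polyC) /char_poly -det_mulmx /char_poly_mx mulmxBr; congr (\det _).
rewrite -map_mxM mulmxA UV1 mul1mx.
by rewrite mul_mx_scalar.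
Qed.

Lemma seifert_poly_lead (R : comNzRingType) n (U V : 'M[R]_n) :
  V *m U = 1%:M -> (seifert_poly U)`_n = \det U.
Proof.
move/seifert_poly_char ->; rewrite coefCM.
have /monicP := char_poly_monic (V *m U^T).
by rewrite /lead_coef size_char_poly => ->; rewrite mulr1.
Qed.

Lemma seifert_poly_trace (R : comNzRingType) n (U V : 'M[R]_n) :
  (0 < n)%N -> V *m U = 1%:M -> \det U = 1 ->
  (seifert_poly U)`_n.-1 = - \tr (V *m U^T).
Proof.
by move=> n0 /seifert_poly_char -> ->; rewrite mul1r char_poly_trace.
Qed.

(** The hypothesis says that [A' = D A D^-1] for the diagonal matrix [D] with
    entries ['X ^ f u]; it avoids negative powers of ['X]. *)
Lemma det_gauge (R : idomainType) n (f : 'I_n -> nat) (A A' : 'M[{poly R}]_n) :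
  (forall u v, A' u v * 'X^(f v) = 'X^(f u) * A u v) -> \det A' = \det A.
Proof.
move=> AA'; pose D := diag_mx (\row_v 'X^(f v)) : 'M[{poly R}]_n.
have D_neq0 : \det D != 0.
  by rewrite det_diag; apply/prodf_neq0 => i _; rewrite mxE monic_neq0 ?monicXn.
apply: (mulIf D_neq0); rewrite [RHS]mulrC -!det_mulmx; congr (\det _).
apply/matrixP => u v; rewrite mul_mx_diag mul_diag_mx !mxE; exact: AA'.
Qed.

(** * Sequences and paths *)

Lemma eq_path_in (T : Type) (e e1 e2 : rel T) x p :
  (forall y z, e y z -> e1 y z = e2 y z) -> path e x p -> path e1 x p = path e2 x p.
Proof. by move=> e12; elim: p x => //= y p IHp x /andP[/e12 -> /IHp ->]. Qed.

Lemma path_inside (T : Type) (D : pred T) x p :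
  D x -> all D p -> path [rel y z | D y && D z] x p.
Proof. by elim: p x => //= y p IHp x -> /andP[Dy /IHp ->]; rewrite ?Dy. Qed.

(** Of two consecutive vertices of such a path at least one is interior, which
    fails for the one-step path from [x] to [y]. *)
Lemma path_via (T : Type) (P : pred T) x r y :
  all P r -> r <> [::] -> path [rel a b | P a || P b] x (rcons r y).
Proof.
case: r => //= z r /andP[Pz Pr] _; rewrite Pz orbT /=.
by elim: r z Pz Pr => [|t r IHr] z Pz /=; rewrite Pz //= => /andP[/IHr].
Qed.

Lemma nonuniq_split (T : eqType) (p : seq T) : ~~ uniq p ->
  exists x q0 q1 q2, p = q0 ++ x :: q1 ++ x :: q2.
Proof.
elim: p => //= x p IHp; rewrite negb_and negbK.
case/orP=> [xp|/IHp[y [q0 [q1 [q2 ->]]]]]; last by exists y, (x :: q0), q1, q2.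
by case/splitPr: xp => q1 q2; exists x, [::], q1, q2.
Qed.

Section Quivers.
Variable n : nat.
Implicit Types (Q : quiver n) (C : coq n) (c : rel 'I_n) (L : seq 'I_n).
Implicit Types (u v w x y : 'I_n).

(** * Arrows of a quiver and of its mutations *)

Lemma arrow_irrefl Q u : arrow Q u u = false.
Proof. by rewrite /arrow; have /forallP/(_ u)/eqP -> := no_loop Q. Qed.

Lemma arrow_asym Q u v : arrow Q u v -> arrow Q v u = false.
Proof.
rewrite /arrow; have /forallP/(_ u)/forallP/(_ v) := no_2cycle Q.
by case/orP=> /eqP ->; rewrite ?ltnn.
Qed.

Lemma arrow0 Q u v : arrow Q u v = false -> Q u v = 0%N.
Proof. by rewrite /arrow lt0n => /eqP. Qed.

Definition linked Q u v := arrow Q u v || arrow Q v u.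

Lemma linkedC Q u v : linked Q u v = linked Q v u.
Proof. by rewrite /linked orbC. Qed.

Lemma mutation_at Q v x y : (x == v) || (y == v) -> mutation v Q x y = Q y x.
Proof.
have Q0 : Q v v = 0%N by apply: arrow0; apply: arrow_irrefl.
have Q2 : Q x y = 0%N \/ Q y x = 0%N.
  have /forallP/(_ x)/forallP/(_ y)/orP := no_2cycle Q.
  by case=> /eqP; [left | right].
move=> Hv; rewrite !mxE [(y == v) || _]orbC Hv.
by case/orP: Hv => /eqP e; subst; rewrite Q0; lia.
Qed.

Lemma mutation_off Q v x y : x != v -> y != v ->
  mutation v Q x y = (Q x y + Q x v * Q v y - (Q y x + Q y v * Q v x))%N.
Proof. by move=> /negPf xv /negPf yv; rewrite !mxE xv yv /= . Qed.

Lemma arrow_mutation_at Q v x y :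
  (x == v) || (y == v) -> arrow (mutation v Q) x y = arrow Q y x.
Proof. by move=> xyv; rewrite /arrow mutation_at. Qed.

Lemma arrow_mutation_stable Q v x y : x != v -> y != v ->
  ~~ (arrow Q x v && arrow Q v y) -> ~~ (arrow Q y v && arrow Q v x) ->
  arrow (mutation v Q) x y = arrow Q x y.
Proof.
move=> xv yv xvy yvx; rewrite /arrow mutation_off //.
have no_path a b : ~~ (arrow Q a v && arrow Q v b) -> (Q a v * Q v b = 0)%N.
  by rewrite negb_and => /orP[] /negPf/arrow0 ->; rewrite ?muln0.
rewrite !no_path // !addn0.
have /forallP/(_ x)/forallP/(_ y)/orP := no_2cycle Q.
by case=> /eqP ->; rewrite ?subn0 ?sub0n.
Qed.

Lemma arrow_mutation_through Q v x y :
  arrow Q x v -> arrow Q v y -> ~~ arrow Q y x -> arrow (mutation v Q) x y.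
Proof.
move=> xv vy /negPf/arrow0 yx.
have xNv : x != v by apply: contraTneq xv => ->; rewrite arrow_irrefl.
have yNv : y != v by apply: contraTneq vy => ->; rewrite arrow_irrefl.
have vx0 := arrow0 (arrow_asym xv).
rewrite /arrow mutation_off // yx vx0 muln0 subn0.
by rewrite addn_gt0 muln_gt0 [(0 < Q x v)%N]xv [(0 < Q v y)%N]vy orbT.
Qed.

(** * Unipotent companions and cochains of cyclic orders *)

(** With [u] and [v] the ends of an arrow [u -> v]: going clockwise from [u] to
    [v] crosses the place where the circle was cut open into [L]. *)
Definition wraps L : rel 'I_n := fun u v => (index v L < index u L)%N.

(** The unipotent companion with vertices as indices, for an arbitrary 0/1
    cochain [c] in place of the one of a linear order: an arrow [u -> v]
    contributes [-1] to the entry [(u, v)] or, if it wraps, [1] to the entry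
    [(v, u)]. The cochain 0, which may not come from any order, gives the
    identity minus the matrix of arrow numbers. *)
Definition companion_of Q c : 'M[int]_n :=
  \matrix_(u, v) ((u == v)%:R - (~~ c u v * Q u v)%:Z + (c v u * Q v u)%:Z).

Lemma alexanderE C : alexander C = seifert_poly (companion_of C (wraps (lin C))).
Proof.
have tnth_linI : injective (tnth (lin C)) by apply/tuple_uniqP; exact: lin_uniq.
rewrite -(seifert_poly_relabel _ (perm tnth_linI)) /alexander /seifert_poly.
suff -> : companion C = mxsub (perm tnth_linI) (perm tnth_linI)
            (companion_of C (wraps (lin C))) by [].
apply/matrixP => i j; rewrite !mxE !permE /wraps (inj_eq tnth_linI).
have indexE k : index (tnth (lin C) k) (lin C) = k.
  by rewrite (tnth_nth (tnth (lin C) k)) index_uniq ?size_tuple ?lin_uniq.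
rewrite !indexE -(inj_eq val_inj) /=.
case: (ltngtP i j) => [_|_|/val_inj->].
- by rewrite mul1n sub0r opprB addrC mul1n.
- by rewrite !mul0n subr0 addr0.
- by rewrite !(arrow0 (arrow_irrefl _ _)) !muln0 subr0 addr0.
Qed.

(** Equality of the cohomology classes of [c] and [c'] on the graph of [Q]. *)
Definition gauge Q c c' := exists f : 'I_n -> int, forall u v, arrow Q u v ->
  (c' u v : nat)%:Z = (c u v : nat)%:Z + f v - f u.

Lemma gauge_refl Q c : gauge Q c c.
Proof. by exists (fun=> 0) => u v _; lia. Qed.

Lemma gauge_sym Q c c' : gauge Q c c' -> gauge Q c' c.
Proof. by case=> f fP; exists (fun u => - f u) => u v /fP; lia. Qed.

Lemma gauge_trans Q c1 c2 c3 : gauge Q c1 c2 -> gauge Q c2 c3 -> gauge Q c1 c3.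
Proof.
case=> f fP [g gP]; exists (fun u => f u + g u) => u v uv.
by have := fP u v uv; have := gP u v uv; lia.
Qed.

Lemma companion_of_pencil Q c u v :
  ('X *: map_mx polyC (companion_of Q c) - map_mx polyC (companion_of Q c)^T) u v
  = (u == v)%:R * ('X - 1) - (Q u v)%:R * 'X^(~~ c u v) + (Q v u)%:R * 'X^(c v u).
Proof.
rewrite !mxE eq_sym !(polyCD, polyCN) !polyCMn.
by case: (c u v); case: (c v u); case: (v == u) => /=;
  rewrite ?mul0n ?mul1n ?mulr0n ?mulr1n; ring.
Qed.

(** An arrow [u -> v] contributes ['X ^ (1 - c u v)] to the entry [(u, v)] and
    [- 'X ^ (c u v)] to the entry [(v, u)], so a coboundary conjugates the matrix
    by a diagonal one. *)
Lemma seifert_poly_gauge Q c c' :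
  gauge Q c c' -> seifert_poly (companion_of Q c') = seifert_poly (companion_of Q c).
Proof.
case=> f fP.
(* Shifting the potential by a constant makes its values natural numbers. *)
pose K : int := \sum_u `|f u|.
have fK u : 0 <= K + f u.
  rewrite /K (bigD1 u) //=.
  have : 0 <= \sum_(w | w != u) `|f w| by apply: sumr_ge0.
  by move: (bigop _ _ _) => S; have := ler_norm (- f u); rewrite normrN; lia.
pose g u := absz (K + f u).
have gE u : (g u)%:Z = K + f u by rewrite /g gez0_abs.
apply: (@det_gauge _ _ g) => u v; rewrite !companion_of_pencil.
rewrite mulrDl mulrBl [RHS]mulrDr [X in _ = X + _]mulrBr.
congr (_ - _ + _).
- by case: eqP => [->|_]; rewrite ?mul0r ?mulr0 // !mul1r mulrC.
- have [uv|/negPf uv] := boolP (arrow Q u v); last by rewrite (arrow0 uv) !mul0r mulr0.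
  rewrite -mulrA -exprD [RHS]mulrCA -exprD; congr (_ * 'X^_).
  have := fP _ _ uv; have := gE u; have := gE v.
  by case: (c u v); case: (c' u v) => /=; lia.
- have [vu|/negPf vu] := boolP (arrow Q v u); last by rewrite (arrow0 vu) !mul0r mulr0.
  rewrite -mulrA -exprD [RHS]mulrCA -exprD; congr (_ * 'X^_).
  have := fP _ _ vu; have := gE u; have := gE v.
  by case: (c v u); case: (c' v u) => /=; lia.
Qed.

Definition full L := forall u, u \in L.

(** Cutting the circle elsewhere changes the cochain by the coboundary of the
    indicator of the vertices moved from the front to the back. *)
Lemma wraps_rot L k : uniq L -> full L -> exists f : 'I_n -> int, forall u v,
  (wraps (rot k L) u v : nat)%:Z = (wraps L u v : nat)%:Z + f v - f u.
Proof.
rewrite /wraps /rot => Lu Lf; have := cat_take_drop k L.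
move: (take k L) (drop k L) => p q pqL; subst L; move: Lu.
rewrite cat_uniq => /and3P[_ /hasPn pq _].
exists (fun u => - (u \in p : nat)%:Z) => u v.
have side w : w \in p /\ w \notin q /\ (index w p < size p)%N \/
              w \notin p /\ w \in q /\ (index w q < size q)%N.
  have [wp|wp] := boolP (w \in p); [left|right]; rewrite !index_mem.
    by split; [|split=> //; apply/negP => /pq; rewrite wp].
  by have := Lf w; rewrite mem_cat (negPf wp) /= => ->.
rewrite !index_cat.
by case: (side u) => [[-> [/negPf -> ?]] | [/negPf -> [-> ?]]];
  case: (side v) => [[-> [/negPf -> ?]] | [/negPf -> [-> ?]]] /=; lia.
Qed.

Lemma gauge_rot Q L k : uniq L -> full L -> gauge Q (wraps L) (wraps (rot k L)).
Proof. by move=> Lu Lf; have [f fP] := wraps_rot k Lu Lf; exists f. Qed.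

Lemma lin_full C : full (lin C).
Proof.
move=> u; have sub : {subset lin C <= enum (ordinal n)} by move=> w _; rewrite mem_enum.
have [|_ ->] := uniq_min_size (lin_uniq C) sub; last by rewrite mem_enum.
exact: eq_leq (etrans (size_enum_ord n) (esym (size_tuple (lin C)))).
Qed.

(** A wiggle exchanges two neighbours in the circle that no arrow joins, so
    after a rotation it changes the cochain on no arrow. *)
Lemma wiggle_equiv_gauge C C' : wiggle_equiv C C' ->
  quiv C' = quiv C /\ gauge C (wraps (lin C)) (wraps (lin C')).
Proof.
elim=> {C C'} [C C'|C|C C' _ [QC' g]|C1 C2 C3 _ [Q21 g1] _ [Q32 g2]].
- case=> [[-> [k ->]] | [-> [u [v [s [k [k' [uv vu Lk Lk']]]]]]]]; split=> //.
    by apply: gauge_rot; [exact: lin_uniq | exact: lin_full].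
  apply: gauge_trans (gauge_rot C k (lin_uniq C) (@lin_full C)) _.
  apply: gauge_trans (gauge_sym (gauge_rot C k' (lin_uniq C') (@lin_full C'))).
  rewrite Lk Lk'; exists (fun=> 0) => x y xy; rewrite /wraps /=.
  have uNv : u != v.
    by have := lin_uniq C; rewrite -(rot_uniq k) Lk /= inE negb_or; case/and3P=> /andP[].
  have [xu|xu] := eqVneq u x; have [yu|yu] := eqVneq u y;
  have [xv|xv] := eqVneq v x; have [yv|yv] := eqVneq v y; subst;
    rewrite ?eqxx // ?xy // in uNv uv vu *; lia.
- by split=> //; apply: gauge_refl.
- by rewrite QC'; split=> //; apply: gauge_sym.
- by rewrite Q32; split=> //; rewrite Q21 in g2; apply: gauge_trans g1 g2.
Qed.

(** * Windings of closed walks *)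

Fixpoint walk_sum (h : 'I_n -> 'I_n -> int) x p : int :=
  if p is y :: p' then h x y + walk_sum h y p' else 0.

Definition cycle_sum (h : 'I_n -> 'I_n -> int) (p : seq 'I_n) : int :=
  if p is x :: p' then walk_sum h x (rcons p' x) else 0.

Lemma walk_sum_cat h x p q :
  walk_sum h x (p ++ q) = walk_sum h x p + walk_sum h (last x p) q.
Proof. by elim: p x => [|y p IHp] x /=; rewrite ?add0r // IHp addrA. Qed.

Lemma cycle_sum_rot h k p : cycle_sum h (rot k p) = cycle_sum h p.
Proof.
rewrite -[in RHS](cat_take_drop k p) /rot.
case: (take k p) (drop k p) => [|x r] [|y s]; rewrite /= ?cats0 //.
rewrite !rcons_cat -!cat_rcons /= !walk_sum_cat !last_rcons /=.
by rewrite addrC.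
Qed.

Lemma eq_walk_sum (w w' : 'I_n -> 'I_n -> int) (e : rel 'I_n) x p :
  (forall y z, e y z -> w y z = w' y z) -> path e x p -> walk_sum w x p = walk_sum w' x p.
Proof.
by move=> ww'; elim: p x => //= y p IHp x /andP[/ww' -> /IHp ->].
Qed.

Lemma walk_sum_potential (w w' : 'I_n -> 'I_n -> int) (e : rel 'I_n)
    (f : 'I_n -> int) x p :
  (forall y z, e y z -> w' y z = w y z + f z - f y) -> path e x p ->
  walk_sum w' x p = walk_sum w x p + f (last x p) - f x.
Proof.
move=> ww'; elim: p x => [|y p IHp] x /=; first by lia.
by case/andP=> /ww' -> /IHp ->; ring.
Qed.

(** The real content: placing the vertices on the circle, an arrow followed
    forwards moves clockwise and one followed backwards moves counterclockwise,
    by less than a turn; around a closed walk the windings add up to the number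
    of turns. *)
Definition winding Q c u v : int :=
  (arrow Q u v && c u v)%:Z - (arrow Q v u && c v u)%:Z.

Lemma winding_anti Q c u v : winding Q c v u = - winding Q c u v.
Proof. by rewrite /winding opprB. Qed.

Lemma cycle_sum_gauge Q c c' p : gauge Q c c' -> cycle (linked Q) p ->
  cycle_sum (winding Q c') p = cycle_sum (winding Q c) p.
Proof.
case=> f fP; case: p => //= x p xp.
rewrite (walk_sum_potential (w := winding Q c) (f := f) _ xp) ?last_rcons ?addrK //.
move=> y z; rewrite /winding => /orP[yz|zy].
  by rewrite yz (arrow_asym yz) /= fP //; ring.
by rewrite zy (arrow_asym zy) /= fP //; ring.
Qed.

(** * Proper mutations *)

(** The effect of a proper mutation at [v] on cochains, when the circle is cut
    just before [v]: before the mutation [v] comes first, and by properness all of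
    [Out v] precedes [In v]; afterwards [v] lies between the two sets, and all other
    pairs keep their order. *)
Record proper_shift Q v c c' : Prop := ProperShift {
  shift_first x : x != v -> c v x = false /\ c x v = true;
  shift_total x y : x != y -> c y x = ~~ c x y;
  shift_off x y : x != v -> y != v -> c' x y = c x y;
  shift_out x : arrow Q v x -> c' v x = true /\ c' x v = false;
  shift_in x : arrow Q x v -> c' v x = false /\ c' x v = true;
  shift_sep x y : arrow Q v x -> arrow Q y v -> c x y = false /\ c y x = true }.

(** The companions are congruent. With [v] first, the new arrows created at [v]
    are produced by subtracting multiples of row [v] (and of column [v]) at the
    vertices of [Out v]; together with a change of sign at [v] this is the
    congruence by an involution [G], a rank-one perturbation of the identity. *)
Lemma seifert_poly_mutation Q v c c' : proper_shift Q v c c' ->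
  seifert_poly (companion_of (mutation v Q) c') = seifert_poly (companion_of Q c).
Proof.
case=> first total off out inn sep.
(* [G] subtracts [g a] times row [v] from row [a]; the entry 2 at [v] makes it
   change the sign of row [v], and makes [G] an involution. *)
pose g : 'cV[int]_n := \col_a (if a == v then 2 else - (Q v a)%:Z).
pose e : 'rV[int]_n := delta_mx 0 v.
pose G := 1%:M - g *m e.
pose U := companion_of Q c.
have eg : e *m g = 2%:M.
  by rewrite -rowE; apply/matrixP => i j; rewrite !ord1 !mxE eqxx.
have G2 : G *m G = 1%:M.
  rewrite /G mulmxBr mulmx1 mulmxBl mul1mx.
  rewrite mulmxA -[g *m e *m g]mulmxA eg mul_mx_scalar -scalemxAl.
  by rewrite scaler_nat mulr2n opprB addrK subrK.
have detG2 : (\det G) ^+ 2 = 1 by rewrite expr2 -det_mulmx G2 det1.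
suff -> : companion_of (mutation v Q) c' = G *m U *m G^T.
  by rewrite seifert_poly_congr detG2 mul1r.
have Qvv : Q v v = 0%N by apply: arrow0; apply: arrow_irrefl.
have Uvv : U v v = 1 by rewrite mxE eqxx Qvv !muln0.
have GX (X : 'M_n) a b : (G *m X) a b = X a b - g a 0 * X v b.
  by rewrite mulmxBl mul1mx -mulmxA -rowE !mxE big_ord1 !mxE.
have XG (X : 'M_n) a b : (X *m G^T) a b = X a b - g b 0 * X a v.
  by rewrite -[X]trmxK -trmx_mul mxE GX !mxE.
apply/matrixP => a b; rewrite XG !GX Uvv.
have two_cycle x y : Q x y = 0%N \/ Q y x = 0%N.
  by have /forallP/(_ x)/forallP/(_ y)/orP[/eqP|/eqP] := no_2cycle Q; [left|right].
have no_path x y : ~~ (arrow Q v x && arrow Q y v) -> (Q v x * Q y v = 0)%N.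
  by rewrite negb_and => /orP[] /negPf/arrow0 ->; rewrite ?muln0.
have Uv x : x != v -> U v x = (Q x v)%:Z - (Q v x)%:Z /\ U x v = 0.
  move=> xv; have [vx xv1] := first x xv.
  rewrite !mxE vx xv1 eq_sym (negPf xv) /= !mul1n !mul0n.
  by split; ring.
have gE x : g x 0 = if x == v then 2 else - (Q v x)%:Z by rewrite mxE.
have side x : x != v -> (~~ c' v x * Q x v = Q x v)%N /\ (c' x v * Q v x = 0)%N /\
                        (~~ c' x v * Q v x = Q v x)%N /\ (c' v x * Q x v = 0)%N.
  move=> xv; case: (two_cycle v x) => [-> | ->]; rewrite !muln0;
    [have := inn x | have := out x].
    have [_ /(_ isT)[-> _]|/negPf/arrow0 -> _] := boolP (arrow Q x v);
      by rewrite ?muln0 ?mul1n ?mul0n.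
  have [_ /(_ isT)[_ ->]|/negPf/arrow0 -> _] := boolP (arrow Q v x);
    by rewrite ?muln0 ?mul1n ?mul0n.
rewrite !gE mxE; have [->|av] := eqVneq a v; have [->|bv] := eqVneq b v.
- by rewrite mutation_at ?eqxx // Qvv Uvv !muln0.
- rewrite !mutation_at ?eqxx ?orbT //.
  have [-> [-> _]] := side b bv; have [-> _] := Uv b bv.
  by rewrite Uvv sub0r; lia.
- rewrite !mutation_at ?eqxx ?orbT //.
  have [_ [_ [-> ->]]] := side a av; have [_ ->] := Uv a av.
  by rewrite (negPf av) Uvv sub0r; lia.
have [-> _] := Uv b bv; have [_ ->] := Uv a av.
rewrite [U a b]mxE !off // !mutation_off //.
have [->|ab] := eqVneq a b.
  have : (Q v b * Q b v = 0)%N by case: (two_cycle v b) => ->; rewrite ?muln0.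
  rewrite mulnC subnn !muln0; have -> : Q b b = 0%N by apply: arrow0; apply: arrow_irrefl.
  by rewrite !muln0; lia.
rewrite (total a b ab); have := two_cycle a b.
have := no_path a b; have := no_path b a; have := sep a b; have := sep b a.
rewrite (total a b ab).
case: (c a b) => /=; rewrite ?mul0n ?mul1n.
  move=> _ H _ H2 _; have : (Q v a * Q b v = 0)%N.
    by apply: H2; apply/negP => /andP[x y]; case: (H x y).
  by nia.
move=> H _ H1 _ ; have : (Q v b * Q a v = 0)%N.
  by apply: H1; apply/negP => /andP[x y]; case: (H x y).
by nia.
Qed.

Lemma same_coq_sym C C' : same_coq C C' -> same_coq C' C.
Proof.
case=> QC [k Lk]; split=> //; exists (size (rot k (lin C)) - k)%N.
by rewrite Lk -/(rotr k _) rotK.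
Qed.

Lemma wiggle_sym C C' : wiggle C C' -> wiggle C' C.
Proof.
case=> QC [u [v [s [k [k' [uv vu Lk Lk']]]]]]; split=> //.
by exists v, u, s, k', k; rewrite QC.
Qed.

Lemma wiggle_equiv_class C C' : wiggle_equiv C C' ->
  proper_mutation_class C C' /\ proper_mutation_class C' C.
Proof.
elim=> {C C'} [C C' []|C|C C' _ []|C1 C2 C3 _ [C12 C21] _ [C23 C32]].
- by move=> s; split; apply: rt_step; [|move/same_coq_sym: s => s]; constructor 1.
- by move=> s; split; apply: rt_step; [|move/wiggle_sym: s => s]; constructor 2.
- by split; apply: rt_refl.
- by [].
- by split; [exact: rt_trans C12 C23 | exact: rt_trans C32 C21].
Qed.

Lemma totally_proper_class C C' :
  totally_proper C -> proper_mutation_class C C' -> totally_proper C'.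
Proof. by move=> tp CC' C'' C'C''; apply: tp; apply: rt_trans CC' C'C''. Qed.

(** The number of wrapping steps in the cyclic triple [u], [v], [w] is
    independent of the cut; it is 1 for a right turn, and with [v] first
    the step from [u] to [v] is already one. *)
Lemma right_turn_order C k v l u w : rot k (lin C) = v :: l ->
  v != u -> v != w -> u != w ->
  right_turn C u v w -> (index w l < index u l)%N.
Proof.
move=> Lk vu vw uw [j]; set s := rot j _ => /andP[uv_s vw_s].
have [f fP] := wraps_rot k (lin_uniq C) (@lin_full C).
have [g gP] := wraps_rot j (lin_uniq C) (@lin_full C).
have := fP u v; have := fP v w; have := fP w u.
have := gP u v; have := gP v w; have := gP w u.
rewrite /wraps -/s Lk /= eqxx (negPf vu) (negPf vw) !ltnS.
have idx_neq : index u l != index w l.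
  apply: contra uw => /eqP iuw; have := lin_full C u; have := lin_full C w.
  rewrite -(mem_rot k) -[u \in _](mem_rot k) Lk !inE ![_ == v]eq_sym.
  rewrite (negPf vu) (negPf vw) /= => wl ul.
  by rewrite -(nth_index w ul) iuw nth_index.
by lia.
Qed.

(** Cut the circle just before [v] and move [v] to the place in front of the
    first vertex of [In v]: properness puts all of [Out v] before that place. *)
Lemma proper_mutation_exists C v : proper_vertex C v ->
  exists C' c c', [/\ coq_mutation v C C', gauge C (wraps (lin C)) c,
    gauge C' (wraps (lin C')) c' & proper_shift C v c c'].
Proof.
move=> vproper; have [k l Lk] := rot_to (lin_full C v).
have Lu : uniq (v :: l) by rewrite -Lk rot_uniq lin_uniq.
have Lf : full (v :: l) by move=> u; rewrite -Lk mem_rot lin_full.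
have lP u : u != v -> u \in l by have := Lf u; rewrite inE; case: eqP.
have inNv u : arrow C u v -> v != u.
  by apply: contraTneq => <-; rewrite arrow_irrefl.
have outNv u : arrow C v u -> v != u.
  by apply: contraTneq => <-; rewrite arrow_irrefl.
have out_in u w : arrow C u v -> arrow C v w -> (index w l < index u l)%N.
  move=> uv vw; apply: (right_turn_order Lk (inNv u uv) (outNv w vw)) (vproper u w uv vw).
  by apply: contraTneq vw => <-; rewrite (arrow_asym uv).
(* If [In v] is empty then [m] is the size of [l] and [v] moves around the whole
   circle. *)
pose m := find (arrow C ^~ v) l.
pose p : seq 'I_n := take m l; pose s : seq 'I_n := drop m l.
have lps : l = p ++ s by rewrite cat_take_drop.
have psu : uniq (p ++ s) by rewrite -lps; case/andP: Lu.
have in_s u : arrow C u v -> u \in s.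
  move=> uv; have := lP u; rewrite eq_sym inNv // lps mem_cat => /(_ isT)/orP[up|//].
  have /(before_find v) : (index u p < m)%N.
    by apply: leq_trans (_ : size p <= m)%N; rewrite ?index_mem // size_take_min geq_minl.
  rewrite -(nth_take v (n0 := m)).
    by rewrite nth_index // uv.
  by apply: leq_trans (_ : size p <= m)%N; rewrite ?index_mem // size_take_min geq_minl.
have out_p w : arrow C v w -> w \in p.
  move=> vw; have := lP w; rewrite eq_sym outNv // lps mem_cat => /(_ isT)/orP[//|ws].
  have ml : (m < size l)%N.
    by rewrite ltnNge; apply/negP => /drop_oversize lm; rewrite /s lm in ws.
  have uv : arrow C (nth v l m) v.
    by apply: (@nth_find _ v (arrow C ^~ v)); rewrite has_find.
  have := out_in _ _ uv vw.
  rewrite index_uniq // ?lps // -lps ltnNge => /negP[].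
  rewrite lps index_cat; case: ifP => [wp|_].
    by move: psu; rewrite cat_uniq => /and3P[_ /hasPn/(_ w ws)]; rewrite wp.
  by rewrite size_takel ?leq_addr // ltnW.
clearbody p s.
have L'P : perm_eq (p ++ v :: s) (lin C).
  apply: (@perm_trans _ (rot k (lin C))); last by rewrite perm_rot.
  by rewrite Lk lps -[v :: s]cat1s -[v :: p ++ s]cat1s perm_catCA.
have L'size : size (p ++ v :: s) == n by rewrite (perm_size L'P) size_tuple.
have L'uniq : uniq (p ++ v :: s) by rewrite (perm_uniq L'P) lin_uniq.
pose C' := @COQ n (mutation v C) (Tuple L'size) L'uniq.
have psdisj w : w \in p -> w \in s -> False.
  by move: Lu; rewrite lps /= cat_uniq => /and4P[_ _ /hasPn ps _] wp /ps; rewrite wp.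
have vp : v \notin p by move: Lu; rewrite lps /= mem_cat negb_or => /andP[/andP[]].
exists C', (wraps (v :: l)), (wraps (p ++ v :: s)); split.
- split=> //; exists p, s, k, 0%N; rewrite rot0 Lk lps; split=> // w.
    by rewrite inE arrow_mutation_at ?eqxx ?orbT //; apply: out_p.
  move=> wp; rewrite inE arrow_mutation_at ?eqxx //.
  by apply/negP => /in_s; apply: psdisj.
- by rewrite -Lk; apply: gauge_rot; [exact: lin_uniq | exact: lin_full].
- exact: gauge_refl.
have index_p w : w \in p -> (index w p < size p)%N by rewrite index_mem.
have s_notp w : w \in s -> (w \in p) = false.
  by move=> ws; apply/negP => wp; apply: psdisj wp ws.
rewrite /wraps lps; split.
- by move=> x xv /=; rewrite eqxx eq_sym (negPf xv).
- move=> x y xy; rewrite -lps -leqNgt [RHS]leq_eqVlt; case: eqP => // eq_index.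
  by rewrite -(nth_index v (Lf x)) eq_index nth_index ?Lf ?eqxx in xy.
- move=> x y; rewrite ![_ == v]eq_sym => /negPf xv /negPf yv.
  rewrite /= xv yv !index_cat /= xv yv.
  case: ifP => [/index_p ?|_]; case: ifP => [/index_p ?|_]; lia.
- move=> x /out_p xp; rewrite !index_cat xp (negPf vp) /= eqxx addn0.
  by have := index_p x xp; lia.
- move=> x vx; have xs := in_s _ vx.
  rewrite !index_cat (s_notp _ xs) (negPf vp) /= eqxx (negPf (inNv x vx)).
  lia.
move=> x y vx yv; rewrite /= (negPf (outNv x vx)) (negPf (inNv y yv)) !index_cat.
rewrite (out_p x vx) (s_notp y (in_s y yv)) /=.
by have := index_p x (out_p x vx); lia.
Qed.

(** Total properness provides a wiggle equivalent order in which [v] is proper,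
    and wiggles change the cochain by a coboundary only; hence any vertex can be
    mutated. *)
Lemma totally_proper_mutation C v : totally_proper C ->
  exists C' c c', [/\ totally_proper C', quiv C' = mutation v C,
    gauge C (wraps (lin C)) c, gauge C' (wraps (lin C')) c' & proper_shift C v c c'].
Proof.
move=> tp; have [C1 CC1 vproper] := tp C (rt_refl _ _ _) v.
have [QC1 g1] := wiggle_equiv_gauge CC1.
have [C' [c [c' [mut g g' shift]]]] := proper_mutation_exists vproper.
rewrite QC1 in g shift; have [_ QC' _] := mut; rewrite QC1 in QC'.
exists C', c, c'; split=> //; last exact: gauge_trans g1 g.
apply: totally_proper_class tp _; apply: rt_trans (wiggle_equiv_class CC1).1 _.
by apply: rt_step; constructor 3; exists v.
Qed.

Lemma totally_proper_reach Q Q' C : mutation_equiv Q Q' ->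
  totally_proper C -> quiv C = Q ->
  exists C', [/\ totally_proper C', quiv C' = Q' & alexander C' = alexander C].
Proof.
move=> QQ'; elim: QQ' C => {Q Q'} [Q Q' [v ->]|Q|Q1 Q2 Q3 _ IH1 _ IH2] C tp QC.
- have [C' [c [c' [tp' QC' g g' shift]]]] := totally_proper_mutation v tp.
  exists C'; split=> //; first by rewrite QC' QC.
  rewrite !alexanderE -(seifert_poly_gauge g) -(seifert_poly_gauge g') QC'.
  exact: seifert_poly_mutation.
- by exists C.
have [C2 [tp2 QC2 <-]] := IH1 C tp QC.
exact: IH2.
Qed.

(** * Chordless cycles in totally proper quivers *)

(** An induced cycle of the underlying graph, once [p] has at least three
    vertices. *)
Definition chordless Q (p : seq 'I_n) := uniq p /\ {in p &, forall x y,
  linked Q x y = (y == next p x) || (x == next p y)}.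

Lemma chordless_rot Q k p : chordless Q p -> chordless Q (rot k p).
Proof.
case=> pu pP; split=> [|x y]; first by rewrite rot_uniq.
by rewrite !mem_rot !next_rot //; apply: pP.
Qed.

Lemma chordless_cycle Q p : chordless Q p -> cycle (linked Q) p.
Proof.
case=> pu pP; apply: (sub_in_cycle (P := mem p) _ (allss p) (cycle_next pu)).
by move=> x y xp yp /eqP xy; rewrite pP // xy eqxx.
Qed.

Lemma chordless_far Q u v w r : chordless Q [:: u, v, w & r] ->
  all (fun z => ~~ linked Q v z) r.
Proof.
case=> pu pP; apply/allP => z zr.
have zP : z \in [:: u, v, w & r] by rewrite !inE zr !orbT.
have vP : v \in [:: u, v, w & r] by rewrite !inE eqxx !orbT.
move: (pu) => /=; rewrite !inE !negb_or => /and4P[/and3P[uv uw ur] /andP[vw vr] wr _].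
have nv : next [:: u, v, w & r] v = w by rewrite /= (eq_sym v) (negPf uv) eqxx.
have nu : next [:: u, v, w & r] u = v by rewrite /= eqxx.
rewrite -negb_or -/(linked Q v z) pP // nv negb_or; apply/andP; split.
  by apply: contraNneq wr => <-.
apply: contraNneq ur => vz.
by have -> : u = z by apply: (can_inj (prev_next pu)); rewrite nu.
Qed.

Definition arr (s : bool) Q : rel 'I_n :=
  fun x y => if s then arrow Q x y else arrow Q y x.

Lemma arr_dir Q x y : linked Q x y -> arr (arrow Q x y) Q x y.
Proof. by rewrite /linked /arr; case: ifP. Qed.

Definition oriented Q p := cycle (arr true Q) p || cycle (arr false Q) p.

Lemma oriented_rot Q k p : oriented Q (rot k p) = oriented Q p.
Proof. by rewrite /oriented !rot_cycle. Qed.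

Lemma winding_stable Q Q' c c' x y :
  arrow Q' x y = arrow Q x y -> arrow Q' y x = arrow Q y x ->
  c' x y = c x y -> c' y x = c y x -> winding Q' c' x y = winding Q c x y.
Proof. by rewrite /winding => -> -> -> ->. Qed.

(** The right turn at [v] makes the passage from [u] to [w] through [v] less
    than a full turn, so the new arrow between [u] and [w] winds exactly as much
    as the two steps it replaces. The boolean [s] treats the passages
    [u -> v -> w] and [w -> v -> u] alike. *)
Lemma winding_through s Q v c c' u w : proper_shift Q v c c' ->
  arr s Q u v -> arr s Q v w -> arr s (mutation v Q) u w ->
  winding (mutation v Q) c' u w = winding Q c u v + winding Q c v w.
Proof.
have forward x y : proper_shift Q v c c' -> arrow Q x v -> arrow Q v y ->
    arrow (mutation v Q) x y ->
    winding (mutation v Q) c' x y = winding Q c x v + winding Q c v y.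
  case=> first _ off _ _ sep xv vy xy.
  have xNv : x != v by apply: contraTneq xv => ->; rewrite arrow_irrefl.
  have yNv : y != v by apply: contraTneq vy => ->; rewrite arrow_irrefl.
  rewrite /winding xy (arrow_asym xy) xv (arrow_asym xv) vy (arrow_asym vy) !off //=.
  by have [_ ->] := sep y x vy xv; have [-> _] := first y yNv; have [_ ->] := first x xNv.
case: s => shift /= uv vw uw; first exact: forward.
by rewrite winding_anti (forward w u) // opprD -!winding_anti addrC.
Qed.

(** Among the other vertices of a chordless cycle only [u] and [w] are linked to
    [v], so the mutation at [v] changes no other link of the remaining cycle. *)
Lemma shortcut_chordless Q u v w r : r <> [::] ->
  chordless Q [:: u, v, w & r] -> linked (mutation v Q) u w ->
  chordless (mutation v Q) [:: u, w & r].
Proof.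
move=> r0 ch uw'; have far := chordless_far ch; have [pu pP] := ch.
have p'u : uniq [:: u, w & r].
  by move: pu; rewrite /= !inE !negb_or => /and4P[/and3P[_ -> ->] _ -> ->].
split=> //.
set p := [:: u, v, w & r] in pP; set p' := [:: u, w & r].
have [uv uw ur [vw vr wr]] : [/\ u != v, u != w, u \notin r
    & [/\ v != w, v \notin r & w \notin r]].
  by move: pu; rewrite /= !inE !negb_or => /and4P[/and3P[-> -> ->] /andP[-> ->] -> _].
have next_eq x : x != u -> x != v -> next p' x = next p x.
  by move=> /negPf xu /negPf xv; rewrite /p /p' /= xu xv.
have next_u : next p u = v by rewrite /= eqxx.
have next'_u : next p' u = w by rewrite /= eqxx.
have sub x : x \in p' -> x \in p.
  by rewrite /p /p' !inE => /or3P[] ->; rewrite ?orbT.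
have p'Nv x : x \in p' -> x != v.
  by apply: contraTneq => ->; rewrite /p' !inE !negb_or eq_sym uv vw vr.
have inner x y : x \in r -> y \in p' ->
    linked (mutation v Q) x y = (y == next p' x) || (x == next p' y).
  move=> xr yp'; have xp' : x \in p' by rewrite /p' !inE xr !orbT.
  have xu : x != u by apply: contraNneq ur => <-.
  have xv := p'Nv x xp'; have yv := p'Nv y yp'.
  have : ~~ linked Q v x by move/allP: far; apply.
  rewrite /linked negb_or => /andP[/negPf vx /negPf xv0].
  rewrite /linked !arrow_mutation_stable ?vx ?xv0 ?andbF //.
  rewrite -/(linked Q x y) pP ?sub // next_eq //; congr (_ || _).
  have [->|yu] := eqVneq y u; last by rewrite next_eq.
  rewrite next_u next'_u (negPf xv); apply/esym/negbTE.
  by apply: contraNneq wr => <-.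
have loop x : linked (mutation v Q) x x = false by rewrite /linked arrow_irrefl.
move=> x y xp' yp'; have [xr|xr] := boolP (x \in r); first exact: inner.
have [yr|yr] := boolP (y \in r); first by rewrite linkedC inner // orbC.
move: xp' yp'; rewrite {1 2}/p' !inE (negPf xr) (negPf yr) !orbF.
case/orP=> /eqP -> /orP[] /eqP ->.
- by rewrite loop next'_u (negPf uw).
- by rewrite uw' next'_u eqxx.
- by rewrite linkedC uw' next'_u eqxx orbT.
have wv : w != v by rewrite eq_sym.
have wu : w != u by rewrite eq_sym.
have wp : w \in p by rewrite /p !inE eqxx !orbT.
by rewrite loop next_eq // -(pP w w) // /linked arrow_irrefl.
Qed.

(** At a source of a chordless cycle the mutation merely reverses the two
    arrows of the cycle at [v], and moves [v] past both of its neighbours in the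
    cycle: for the cut just before [v], neither arrow wraps before or after. *)
Lemma mutation_source C v p : totally_proper C -> chordless C p -> v \in p ->
  (forall x, x \in p -> ~~ arrow C x v) ->
  exists C', [/\ totally_proper C', quiv C' = mutation v C, chordless C' p,
   cycle_sum (winding C' (wraps (lin C'))) p = cycle_sum (winding C (wraps (lin C))) p
   & {in p &, forall x y, arrow C' x y =
        if (x == v) || (y == v) then arrow C y x else arrow C x y}].
Proof.
move=> tp ch vp source; have [pu pP] := ch.
have [C' [c [c' [tp' QC' g g' shift]]]] := totally_proper_mutation v tp.
have arrowE : {in p &, forall x y, arrow C' x y =
    if (x == v) || (y == v) then arrow C y x else arrow C x y}.
  move=> x y xp yp; rewrite QC'; case: ifPn => [xy|]; first exact: arrow_mutation_at.
  rewrite negb_or => /andP[xv yv].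
  by rewrite arrow_mutation_stable // ?(negPf (source x xp)) ?(negPf (source y yp)).
have ch' : chordless C' p.
  split=> // x y xp yp; rewrite -pP // /linked !arrowE //.
  by rewrite [(y == v) || _]orbC; case: ifP => // _; rewrite orbC.
exists C'; split=> //.
rewrite -(cycle_sum_gauge g (chordless_cycle ch)).
rewrite -(cycle_sum_gauge g' (chordless_cycle ch')).
have [first _ off out _ _] := shift.
have at_v y : y \in p -> winding C' c' v y = winding C c v y.
  move=> yp; rewrite /winding !arrowE // eqxx orbT /= (negPf (source y yp)).
  have [vy|_] := boolP (arrow C v y) => //=.
  have yv : y != v by apply: contraTneq vy => ->; rewrite arrow_irrefl.
  by have [_ ->] := out y vy; have [-> _] := first y yv.
case: p {pu pP ch ch' g g'} vp source arrowE at_v => //= x0 p vp source arrowE at_v.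
apply: (eq_walk_sum (e := [rel x y | (x \in x0 :: p) && (y \in x0 :: p)])); last first.
  apply: path_inside; first by rewrite mem_head.
  apply/allP => z; rewrite mem_rcons //.
move=> x y /andP[xp yp].
have [->|xv] := eqVneq x v; first exact: at_v.
have [->|yv] := eqVneq y v; first by rewrite winding_anti at_v // -winding_anti.
by apply: winding_stable; rewrite ?off ?arrowE // (negPf xv) (negPf yv).
Qed.

(** By induction on the length, a mutation removing one vertex from the cycle.
    For an oriented cycle the same reduction would end with an oriented triangle,
    whose winding is 1 or -1. *)
Lemma chordless_cycle_sum C p : totally_proper C -> (2 < size p)%N ->
  chordless C p -> ~~ oriented C p -> cycle_sum (winding C (wraps (lin C))) p = 0.
Proof.
have [m] := ubnP (size p).
elim: m C p => // m IH C p; rewrite ltnS => p_m.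
(* The cycle passes through [v]: mutate there and leave [v] out. *)
have pass D u v w r : totally_proper D -> chordless D [:: u, v, w & r] ->
    ~~ oriented D [:: u, v, w & r] -> (size [:: u, v, w & r] <= m)%N ->
    arrow D u v = arrow D v w ->
    cycle_sum (winding D (wraps (lin D))) [:: u, v, w & r] = 0.
  move=> tp ch or3 p_m' same_dir; set s := arrow D u v in same_dir.
  have [luv lvw] : linked D u v /\ linked D v w.
    by have := chordless_cycle ch; rewrite /= => /and3P[].
  have uv : arr s D u v by apply: arr_dir.
  have vw : arr s D v w by rewrite same_dir; apply: arr_dir.
  have rest : ~~ path (arr s D) w (rcons r u).
    apply: contra or3 => rest.
    have : cycle (arr s D) [:: u, v, w & r] by rewrite /= uv vw.
    by rewrite /oriented; case: (s) => ->; rewrite ?orbT.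
  have [D' [c [c' [tp' QD' g g' shift]]]] := totally_proper_mutation v tp.
  rewrite -(cycle_sum_gauge g (chordless_cycle ch)).
  have far := chordless_far ch.
  have [pu pP] := ch.
  have [uNv uNw ur [vNw vr wr]] : [/\ u != v, u != w, u \notin r
      & [/\ v != w, v \notin r & w \notin r]].
    by move: pu; rewrite /= !inE !negb_or => /and4P[/and3P[-> -> ->] /andP[-> ->] -> _].
  (* A triangle: the right turn at [v] determines the windings of all three
     edges. *)
  have [r0|r0] := eqVneq r [::].
    subst r; have := chordless_cycle ch; rewrite /= andbT => /and3P[_ _ lwu].
    have wu : arr (~~ s) D w u.
      by move: rest lwu; rewrite /= andbT /linked /arr;
        case: (s) => /negPf ->; rewrite ?orbF.
    have [first _ _ _ _ sep] := shift.
    have [vw0 wv1] : c v w = false /\ c w v = true by apply: first; rewrite eq_sym.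
    have [vu0 uv1] := first u uNv.
    rewrite /= addr0; move: uv vw wu; rewrite /winding /arr; case: (s) => /= uv vw wu.
      have [wu0 uw1] := sep w u vw uv.
      rewrite uv vw wu (arrow_asym uv) (arrow_asym vw) (arrow_asym wu).
      by rewrite uv1 vw0 uw1.
    have [uw0 wu1] := sep u w uv vw.
    rewrite uv vw wu (arrow_asym uv) (arrow_asym vw) (arrow_asym wu).
    by rewrite vu0 wv1 wu1.
  have far_r : all (fun z => ~~ linked D z v) r.
    by apply/allP => z zr; rewrite linkedC; move/allP: far; apply.
  (* The edges of the cycle that do not meet [v]: each has an end not linked to
     [v], so the mutation does not affect it. *)
  pose e := [rel x y | ((x != v) && (y != v)) && (~~ linked D x v || ~~ linked D y v)].
  have detour : path e w (rcons r u).
    have inside : path [rel x y | (x != v) && (y != v)] w (rcons r u).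
      apply: (@path_inside _ (fun x => x != v)); first by rewrite eq_sym.
      rewrite all_rcons uNv /=; apply/allP => z zr.
      by apply: contraNneq vr => <-.
    by rewrite (path_relI _ _ w (rcons r u)) inside; apply: path_via far_r (elimN eqP r0).
  have arrow_e x y : e x y -> arrow D' x y = arrow D x y /\ arrow D' y x = arrow D y x.
    rewrite QD' /= /linked !negb_or => /andP[/andP[xv yv]] far_xy.
    rewrite !arrow_mutation_stable //;
      by case/orP: far_xy => /andP[/negPf xv0 /negPf vx0]; rewrite ?xv0 ?vx0 ?andbF.
  have uw_unlinked : ~~ linked D u w.
    rewrite (pP u w) ?inE ?eqxx ?orbT // negb_or; apply/andP; split.
      by rewrite /= eqxx eq_sym.
    apply/eqP => u_next; move: u_next r0 ur.
    rewrite /= [w == u]eq_sym [w == v]eq_sym (negPf uNw) (negPf vNw).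
    by case: (r) => //= z r'; rewrite eqxx => ->; rewrite inE eqxx.
  have uw' : arr s D' u w.
    move: uw_unlinked uv vw; rewrite QD' /linked /arr negb_or => /andP[uw wu].
    by case: (s) => a b; apply: arrow_mutation_through.
  have ch' : chordless D' [:: u, w & r].
    rewrite QD'; apply: shortcut_chordless ch _; first exact/eqP.
    by rewrite -QD' /linked; move: uw'; rewrite /arr; case: (s) => ->; rewrite ?orbT.
  have rest' : ~~ path (arr s D') w (rcons r u).
    rewrite (eq_path_in (e2 := arr s D) _ detour) // => x y /arrow_e[xy yx].
    by rewrite /arr xy yx.
  have or' : ~~ oriented D' [:: u, w & r].
    rewrite /oriented /= -/(arr true D') -/(arr false D').
    move: uw' rest'; rewrite /arr; case: (s) => uw2 /negPf ->;
      by rewrite (arrow_asym uw2) andbF.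
  have := IH D' [:: u, w & r] p_m' tp' _ ch' or'.
  rewrite -(cycle_sum_gauge g' (chordless_cycle ch')) => IHr.
  have {}IHr : cycle_sum (winding D' c') [:: u, w & r] = 0.
    by apply: IHr; case: (r) r0.
  rewrite -IHr /= addrA; congr (_ + _).
    by rewrite QD'; apply/esym/(winding_through shift uv vw); rewrite -QD'.
  apply/esym/(eq_walk_sum (e := e)) => // x y exy.
  have [xy yx] := arrow_e x y exy; have [_ _ off _ _ _] := shift.
  by move: exy => /andP[/andP[xv yv] _]; apply: winding_stable; rewrite ?off.
have pass_rot D k u v w r : totally_proper D -> chordless D p -> ~~ oriented D p ->
    rot k p = [:: u, v, w & r] -> arrow D u v = arrow D v w ->
    cycle_sum (winding D (wraps (lin D))) p = 0.
  move=> tp ch or3 rp same_dir; rewrite -(cycle_sum_rot _ k).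
  rewrite rp; apply: pass => //; first by rewrite -rp; apply: chordless_rot.
    by rewrite -rp oriented_rot.
  by rewrite -rp size_rot.
move=> tp p3 ch or3.
case: p p_m pass_rot p3 ch or3 => [|a [|b [|d r]]] // p_m pass_rot p3 ch or3.
have linked_p := chordless_cycle ch.
have [lab lbd] : linked C a b /\ linked C b d by move: linked_p => /= /and3P[].
(* Look for a passage at [b], then at [d]. If there is none then the arrows
   alternate at [b] and [d]. *)
have [ab_bd|ab_bd] := eqVneq (arrow C a b) (arrow C b d).
  exact: (pass_rot C 0 a b d r tp ch or3 (rot0 _) ab_bd).
case: r p_m pass_rot p3 ch or3 linked_p => [|e r] p_m pass_rot p3 ch or3 linked_p.
  (* Two of the three edges of a triangle have the same direction. *)
  have [bd_da|bd_da] := eqVneq (arrow C b d) (arrow C d a).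
    exact: (pass_rot C 1 b d a [::] tp ch or3 _ bd_da).
  apply: (pass_rot C 2 d a b [::]) => //.
  by move: ab_bd bd_da; do 3!case: arrow.
have rot1p : rot 1 [:: a, b, d, e & r] = [:: b, d, e & rcons r a] by rewrite rot1_cons.
have [bd_de|bd_de] := eqVneq (arrow C b d) (arrow C d e).
  exact: (pass_rot C 1 b d e _ tp ch or3 rot1p bd_de).
have lde : linked C d e by move: linked_p => /= /and4P[].
have ch1 : chordless C [:: b, d, e & rcons r a] by rewrite -rot1p; apply: chordless_rot.
have [bNd aNd eNb] : [/\ b != d, a != d & e != b].
  case: ch => /=; rewrite !inE !negb_or.
  case/and4P=> /and4P[_ -> _ _] /and3P[-> bNe _] _ _ _.
  by rewrite eq_sym bNe.
have far_b := chordless_far ch; have far_d := chordless_far ch1.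
(* One of [b] and [d] is a source; after the mutation there, the cycle passes
   through the other one. *)
have [bd|bd] := boolP (arrow C b d).
  have ba : arrow C b a by move: ab_bd lab; rewrite bd /linked; case: arrow.
  have ed : arrow C e d by move: bd_de lde; rewrite bd /linked; case: arrow.
  have source x : x \in [:: a, b, d, e & r] -> ~~ arrow C x b.
    rewrite 3!inE => /or4P[/eqP->|/eqP->|/eqP->|xr].
    - by rewrite (arrow_asym ba).
    - by rewrite arrow_irrefl.
    - by rewrite (arrow_asym bd).
    by move/allP: far_b => /(_ x xr); rewrite linkedC negb_or => /andP[].
  have [|C' [tp' _ ch' <- arrowE]] := mutation_source tp ch _ source.
    by rewrite !inE eqxx orbT.
  have arrow'_bd : arrow C' b d = false.
    by rewrite arrowE ?inE ?eqxx ?orbT //= (arrow_asym bd).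
  have arrow'_ab : arrow C' a b by rewrite arrowE ?inE ?eqxx ?orbT.
  have arrow'_de : arrow C' d e = false.
    by rewrite arrowE ?inE ?eqxx ?orbT // eq_sym (negPf bNd) (negPf eNb) (arrow_asym ed).
  apply: (pass_rot C' 1 b d e _ tp' ch' _ rot1p _); last by rewrite arrow'_bd.
  by rewrite /oriented /arr /= arrow'_bd (arrow_asym arrow'_ab) andbF.
have db : arrow C d b by move: lbd; rewrite /linked (negPf bd).
have ab : arrow C a b by move: ab_bd; rewrite (negPf bd); case: arrow.
have de : arrow C d e by move: bd_de; rewrite (negPf bd); case: arrow.
have source x : x \in [:: a, b, d, e & r] -> ~~ arrow C x d.
  rewrite -(mem_rot 1) rot1p 3!inE => /or4P[/eqP->|/eqP->|/eqP->|xr].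
  - by [].
  - by rewrite arrow_irrefl.
  - by rewrite (arrow_asym de).
  by move/allP: far_d => /(_ x xr); rewrite linkedC negb_or => /andP[].
have [|C' [tp' _ ch' <- arrowE]] := mutation_source tp ch _ source.
  by rewrite !inE eqxx !orbT.
have arrow'_bd : arrow C' b d by rewrite arrowE ?inE ?eqxx ?orbT.
have arrow'_ab : arrow C' a b.
  by rewrite arrowE ?inE ?eqxx ?orbT // (negPf aNd) (negPf bNd).
have arrow'_de : arrow C' d e = false.
  by rewrite arrowE ?inE ?eqxx ?orbT //= (arrow_asym de).
apply: (pass_rot C' 0 a b d _ tp' ch' _ (rot0 _) _); last by rewrite arrow'_ab.
by rewrite /oriented /arr /= arrow'_de (arrow_asym arrow'_ab) !andbF.
Qed.

(** * Acyclic totally proper quivers *)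

(** The two closed walks obtained by cutting at [x] and [y] (and closing them up
    by the edge between [x] and [y], when these differ) are shorter than [p]. *)
Lemma not_chordless_split Q p : cycle (linked Q) p -> (2 < size p)%N ->
  chordless Q p \/ exists k x q1 y q2, rot k p = x :: q1 ++ y :: q2 /\
    (x = y \/ [/\ linked Q x y, q1 <> [::] & q2 <> [::]]).
Proof.
move=> cyc p3; have [pu|] := boolP (uniq p); last first.
  case/nonuniq_split=> x [q0 [q1 [q2 ->]]]; right.
  exists (size q0), x, q1, x, (q2 ++ q0); rewrite rot_size_cat; split; last by left.
  by rewrite /= -catA.
have [all_next|] := boolP [forall x, forall y, (x \in p) ==> (y \in p) ==>
    (linked Q x y == (y == next p x) || (x == next p y))].
  left; split=> // x y xp yp.
  by apply/eqP; move/forallP: all_next => /(_ x)/forallP/(_ y); rewrite xp yp.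
rewrite negb_forall => /existsP[x]; rewrite negb_forall => /existsP[y].
rewrite !negb_imply => /and3P[xp yp xy_wrong]; right.
have link_next z : z \in p -> linked Q z (next p z) by apply: next_cycle.
have [xy y_next x_next] : [/\ linked Q x y, y != next p x & x != next p y].
  have [y_next|y_next] := eqVneq y (next p x).
    by rewrite y_next link_next // eqxx in xy_wrong.
  have [x_next|x_next] := eqVneq x (next p y).
    by rewrite linkedC {1}x_next link_next // -x_next eqxx orbT in xy_wrong.
  by move: xy_wrong; rewrite (negPf y_next) (negPf x_next) eqbF_neg negbK.
have [k s rp] := rot_to xp.
have ys : y \in s.
  have : y \in x :: s by rewrite -rp mem_rot.
  by rewrite inE => /orP[/eqP yx|//]; rewrite yx /linked arrow_irrefl in xy.
case/splitPr: ys rp => q1 q2 rp; exists k, x, q1, y, q2; split=> //; right; split=> //.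
  move=> q1_nil; move: y_next; rewrite -(next_rot k) // rp q1_nil /= eqxx.
  by rewrite eqxx.
move=> q2_nil; move: x_next; rewrite -(next_rot k) // rp q2_nil.
have rpu : uniq (x :: q1 ++ [:: y]) by rewrite -q2_nil -rp rot_uniq.
by rewrite -(next_rot (size (x :: q1))) // -cat_cons rot_size_cat /= !eqxx.
Qed.

Lemma acyclic_not_oriented Q p : acyclic Q -> p <> [::] -> ~~ oriented Q p.
Proof.
move=> ac p0; rewrite /oriented negb_or; apply/andP; split; apply/negP=> cyc.
  by apply: p0; apply: ac.
have /ac rev0 : cycle (arrow Q) (rev p) by rewrite rev_cycle.
by apply: p0; rewrite -[p]revK rev0.
Qed.

Lemma acyclic_cycle_sum C p : totally_proper C -> acyclic C ->
  cycle (linked C) p -> cycle_sum (winding C (wraps (lin C))) p = 0.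
Proof.
move=> tp ac; have [m] := ubnP (size p).
elim: m p => // m IH p; rewrite ltnS => p_m cyc.
set W := winding _ _.
have [p_le2|p3] := leqP (size p) 2.
  case: p {p_m} cyc p_le2 => [|x [|y [|z p]]] //= cyc _.
    by rewrite /linked arrow_irrefl in cyc.
  by rewrite /W winding_anti addr0 addNr.
have [ch|[k [x [q1 [y [q2 [rp split]]]]]]] := not_chordless_split cyc p3.
  by apply: chordless_cycle_sum => //; apply: acyclic_not_oriented => //; case: (p) p3.
rewrite -(cycle_sum_rot _ k).
move: cyc p_m; rewrite -(rot_cycle k) -(size_rot k) rp /= !rcons_cat rcons_cons.
rewrite -cat_rcons cat_path last_rcons walk_sum_cat last_rcons => /andP[xy yx].
rewrite size_cat /= addnS => p_m.
case: split => [xy_eq|[lxy q1_nil q2_nil]].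
  subst y; have sum1 := IH (x :: q1); have sum2 := IH (x :: q2).
  by rewrite -[RHS]addr0 -[X in _ = X + _]sum1 -?[X in _ = _ + X]sum2 //=; lia.
have lyx : linked C y x by rewrite linkedC.
have := IH (x :: rcons q1 y); rewrite /= rcons_path last_rcons xy lyx => /(_ _ isT).
rewrite -[rcons (rcons _ _) _]cats1 walk_sum_cat last_rcons /= addr0 => sum1.
have := IH (y :: rcons q2 x); rewrite /= rcons_path last_rcons yx lxy => /(_ _ isT).
rewrite -[rcons (rcons _ _) _]cats1 walk_sum_cat last_rcons /= addr0 => sum2.
have size1 : (size q1 > 0)%N by case: (q1) q1_nil.
have size2 : (size q2 > 0)%N by case: (q2) q2_nil.
rewrite !size_rcons in sum1 sum2.
have {}sum1 := sum1 ltac:(lia); have {}sum2 := sum2 ltac:(lia).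
by move: sum1 sum2; rewrite (winding_anti _ _ x y) -/W; lia.
Qed.

(** Integrate [h] along a path from the root of each connected component. *)
Lemma potential_exists Q (h : 'I_n -> 'I_n -> int) :
  (forall p, cycle (linked Q) p -> cycle_sum h p = 0) ->
  exists f : 'I_n -> int, forall u v, linked Q u v -> h u v = f v - f u.
Proof.
move=> sum0.
have closed x p : path (linked Q) x p -> last x p = x -> walk_sum h x p = 0.
  case/lastP: p => // p y; rewrite last_rcons => xp yx; subst y.
  exact: (sum0 (x :: p)).
have sym : connect_sym (linked Q) by apply: sym_connect_sym => x y; apply: linkedC.
pose reaches u z := exists2 p, path (linked Q) (fingraph.root (linked Q) u) p /\
  last (fingraph.root (linked Q) u) p = u & z = walk_sum h (fingraph.root (linked Q) u) p.
have reachable u : exists z, reaches u z.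
  have : connect (linked Q) (fingraph.root (linked Q) u) u by rewrite sym connect_root.
  case/connectP=> p xp up.
  by exists (walk_sum h (fingraph.root (linked Q) u) p), p.
have [f fP] := fin_all_exists reachable.
exists f => u v uv.
have [p [xp up] ->] := fP u; have [q [xq vq] ->] := fP v.
have same_root : fingraph.root (linked Q) u = fingraph.root (linked Q) v.
  by apply/eqP; rewrite root_connect // connect1.
rewrite same_root in xp up *.
move: xp up xq vq; set x := fingraph.root _ v => xp up xq vq.
have /connectP[t vt xt] : connect (linked Q) v x by apply: connect_root.
have := closed x (p ++ v :: t); rewrite cat_path walk_sum_cat last_cat up /= xp uv vt.
have := closed x (q ++ t); rewrite cat_path walk_sum_cat last_cat vq xq vt.
by move=> /(_ isT (esym xt)) e1 /(_ isT (esym xt)) e2; lia.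
Qed.

(** Up to coboundaries a totally proper order on an acyclic quiver is one
    without wrapping arrows, that is, one which increases along all arrows. *)
Lemma acyclic_gauge C : totally_proper C -> acyclic C ->
  gauge C (wraps (lin C)) (fun _ _ => false).
Proof.
move=> tp ac; have [f fP] := potential_exists (fun p => acyclic_cycle_sum tp ac (p := p)).
exists (fun u => - f u) => u v uv.
have := fP u v; rewrite /linked /winding uv (arrow_asym uv) /= => /(_ isT); lia.
Qed.

End Quivers.

(** * The Markov invariant of an acyclic quiver *)

Lemma companion_ofB n (Q : quiver n) (c : rel 'I_n) :
  companion_of Q c - (companion_of Q c)^T = - exchange_mx Q.
Proof.
apply/matrixP => u v; rewrite !mxE [v == u]eq_sym.
by case: (c u v); case: (c v u) => /=; lia.
Qed.

(** The difference [U - U^T] is minus the exchange matrix; squaring removes the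
    sign [(-1) ^ n]. *)
Lemma alexander_horner1 n (C : coq n) :
  (alexander C).[1] ^+ 2 = \det (exchange_mx C) ^+ 2.
Proof.
rewrite alexanderE seifert_poly_horner1 companion_ofB -scaleN1r detZ exprMn.
by rewrite sqrr_sign mul1r.
Qed.

Lemma det_companion n (C : coq n) : \det (companion C) = 1.
Proof.
rewrite -det_tr det_trig; first by apply: big1 => i _; rewrite !mxE ltnn eqxx.
apply/is_trig_mxP => i j ij; rewrite !mxE ltnNge ltnW //=.
by case: eqP ij => // ->; rewrite ltnn.
Qed.

Lemma alexander_lead n (C : coq n) : (alexander C)`_n = 1.
Proof.
rewrite -(det_companion C); apply: (@seifert_poly_lead _ _ _ (invmx (companion C))).
by rewrite mulVmx // unitmxE det_companion unitr1.
Qed.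

Section Acyclic.
Variables (m : nat) (Q : quiver m.+1).
Hypothesis Qac : acyclic Q.
Let N : 'M[int]_m.+1 := \matrix_(u, v) (Q u v)%:Z.
(** The inverse of [1 - N]: its entries count the walks along arrows. *)
Let walks : 'M[int]_m.+1 := \sum_(k < m.+1) N ^+ k.

(** A grading of the vertices, from 1 to the size of the quiver, which increases
    along arrows. *)
Let ancestors (v : 'I_m.+1) := #|[pred u | connect (arrow Q) u v]|.

Lemma ancestors_arrow u v : arrow Q u v -> (ancestors u < ancestors v)%N.
Proof.
move=> uv; apply: proper_card; apply/properP; split.
  by apply/subsetP => w; rewrite !inE => /connect_trans; apply; apply: connect1.
exists v; rewrite !inE ?connect0 //; apply/negP => /connectP[p vp up].
have : v :: p = [::] by apply: Qac; rewrite /= rcons_path vp -up.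
by [].
Qed.

Lemma pow_arrows_ge0 k u v : 0 <= (N ^+ k) u v.
Proof.
elim: k u v => [|k IHk] u v; first by rewrite expr0 mxE; case: eqP.
rewrite exprS mxE; apply: sumr_ge0 => w _; apply: mulr_ge0 => //.
by rewrite mxE.
Qed.

Lemma pow_ancestors k u v : (N ^+ k) u v != 0 -> (ancestors u + k <= ancestors v)%N.
Proof.
elim: k u v => [|k IHk] u v; first by rewrite expr0 mxE addn0; have [->|] := eqVneq u v.
rewrite exprS mxE => sum_neq0.
have [w] : exists w, N u w * (N ^+ k) w v != 0.
  apply/existsP; apply: contraNT sum_neq0; rewrite negb_exists => /forallP all0.
  by rewrite big1 // => w _; apply/eqP; move: (all0 w); rewrite negbK.
rewrite mulf_eq0 negb_or => /andP[uw /IHk].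
have /ancestors_arrow : arrow Q u w by move: uw; rewrite mxE /arrow lt0n.
by lia.
Qed.

Lemma walks_inverse : walks *m (1 - N) = 1%:M.
Proof.
have Nn0 : N ^+ m.+1 = 0.
  apply/matrixP => u v; rewrite mxE; apply/eqP/negP => /negP/pow_ancestors.
  have : (0 < ancestors u)%N by apply/card_gt0P; exists u; rewrite inE connect0.
  have : (ancestors v <= m.+1)%N by rewrite /ancestors (leq_trans (max_card _)) ?card_ord.
  by lia.
apply: mulmx1C; have := subrX1 N m.+1; rewrite Nn0 sub0r -/walks => /(congr1 -%R).
by rewrite opprK -mulNr opprB => inverse; apply: esym inverse.
Qed.

Lemma walks_ge0 u v : 0 <= walks u v.
Proof. by rewrite summxE; apply: sumr_ge0 => k _; apply: pow_arrows_ge0. Qed.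

Lemma walks_diag u : walks u u = 1.
Proof.
rewrite summxE (bigD1 ord0) //= expr0 mxE eqxx big1 ?addr0 // => k k0.
by apply/eqP; apply: contraNT k0 => /pow_ancestors; rewrite -val_eqE /=; lia.
Qed.

Lemma arrows_le_walks u v : N u v <= walks u v.
Proof.
have walksE : walks = 1 + N *m walks.
  have := mulmx1C walks_inverse; rewrite mulmxBl mul1mx => /eqP.
  by rewrite subr_eq => /eqP.
have term_ge0 w : 0 <= N u w * walks w v by rewrite mulr_ge0 ?walks_ge0 // mxE.
have -> : walks u v = (u == v)%:R + \sum_w N u w * walks w v.
  by rewrite {1}walksE !mxE.
rewrite (bigD1 v) //= walks_diag mulr1.
by rewrite addrCA lerDl addr_ge0 ?ler0n //; apply: sumr_ge0.
Qed.

(** The hypothesis amounts to [det (1 - N) = 1]; it will hold because the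
    polynomial is the Alexander polynomial of a cyclically ordered quiver, hence
    monic. *)
Lemma acyclic_markov :
  (seifert_poly (1 - N))`_m.+1 = 1 ->
  m.+1%:Z + (seifert_poly (1 - N))`_m = \sum_u \sum_v walks u v * N u v.
Proof.
rewrite (seifert_poly_lead walks_inverse) => det1N.
rewrite (seifert_poly_trace _ walks_inverse) //.
rewrite linearB /= mulmxBr trmx1 mulmx1 linearB /= opprB.
have -> : \tr walks = m.+1%:Z.
  rewrite /mxtrace (eq_bigr (fun=> 1)) ?sumr_const ?card_ord ?natz // => u _.
  exact: walks_diag.
rewrite addrC subrK; apply: eq_bigr => u _; rewrite mxE; apply: eq_bigr => v _.
by rewrite [N^T v u]mxE.
Qed.

(** In the absence of 2-cycles each pair of opposite entries of the exchange
    matrix contributes twice the square of one arrow number; and each walk number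
    bounds the corresponding arrow number. *)
Lemma exchange_frobenius_le :
  \sum_u \sum_v (exchange_mx Q u v) ^+ 2 <= 2 * \sum_u \sum_v walks u v * N u v.
Proof.
have -> : \sum_u \sum_v (exchange_mx Q u v) ^+ 2 = 2 * \sum_u \sum_v N u v ^+ 2.
  rewrite mulr2n mulrDl mul1r [X in _ = _ + X]exchange_big -big_split.
  apply: eq_bigr => u _ /=.
  rewrite -big_split; apply: eq_bigr => v _ /=; rewrite !mxE.
  have /forallP/(_ u)/forallP/(_ v)/orP := no_2cycle Q.
  by case=> /eqP ->; ring.
apply: ler_wpM2l => //; apply: ler_sum => u _; apply: ler_sum => v _.
by rewrite expr2 ler_wpM2r ?arrows_le_walks //; rewrite mxE.
Qed.

End Acyclic.

(** For [n = 0] the polynomial is 1, the index [n.-1] is 0 and [M = 1]. *)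
Lemma markov_bound n (C : coq n) : totally_proper C -> mutation_acyclic C ->
  0 <= markov C /\ \det (exchange_mx C) ^+ 2 <= (2 * markov C) ^+ n.
Proof.
case: n C => [|m] C tp [Q' CQ' ac].
  by rewrite /markov /alexander !det_mx00 coef1 expr0 expr1n.
have [C' [tp' QC' alexE]] := totally_proper_reach CQ' tp erefl.
rewrite -QC' in ac.
pose N : 'M[int]_m.+1 := \matrix_(u, v) (C' u v)%:Z.
have alexN : alexander C = seifert_poly (1 - N).
  rewrite -alexE alexanderE -(seifert_poly_gauge (acyclic_gauge tp' ac)).
  by congr seifert_poly; apply/matrixP => u v; rewrite !mxE mul1n mul0n addr0.
have M_E := acyclic_markov ac; rewrite -/N -alexN alexander_lead in M_E.
have {}M_E := M_E erefl.
have frob := exchange_frobenius_le ac; rewrite -/N -M_E -/(markov C) in frob.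
have frob_ge0 : 0 <= \sum_u \sum_v (exchange_mx C' u v) ^+ 2.
  by apply: sumr_ge0 => u _; apply: sumr_ge0 => v _; apply: sqr_ge0.
have M_ge0 : 0 <= 2 * markov C := le_trans frob_ge0 frob.
split; first by rewrite -(pmulr_rge0 _ (isT : 0 < 2 :> int)).
rewrite -alexander_horner1 -alexE alexander_horner1.
by apply: le_trans (det_sqr_le _) _; apply: lerXn2r.
Qed.

Theorem corollary6p8 (R : realType) (n : nat) (C : coq n)
    (Cproper : totally_proper C) (Cacyclic : mutation_acyclic (quiv C)) :
  0 <= markov C /\
  ((\det (exchange_mx (quiv C)))%:~R : R)
    <= (2 * (markov C)%:~R) `^ (n%:R / 2).
Proof.
have [M_ge0 det_le] := markov_bound Cproper Cacyclic; split=> //.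
have MR_ge0 : 0 <= 2 * (markov C)%:~R :> R by rewrite mulr_ge0 ?ler0z.
apply: le_trans (ler_norm _) _.
rewrite -(@ler_pXn2r _ 2) ?nnegrE ?powR_ge0 //.
rewrite real_normK ?num_real // -[X in _ <= X]powR_mulrn ?powR_ge0 // -powRrM.
rewrite divfK ?pnatr_eq0 // powR_mulrn //.
have := det_le; rewrite -(ler_int R) !rmorphXn /= rmorphM /=.
by [].
Qed.
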